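(* Let $0<d\le\infty$ and let $\mu$ be a symmetric finite positive Borel measure on $(-d,d)$ with infinite support. Let $r\ge0$ be an integer and $M_0,\dots,M_{2r+1}\ge0$. Let $\{q_n\}_{n\ge0}$ be the orthonormal polynomials with respect to $\langle p,q\rangle=\int p(x)q(x)\,d\mu(x)+\sum_{i=0}^{2r+1}M_i\,p^{(i)}(0)\,q^{(i)}(0)$, and let $\{p_n^{[4j]}\}_{n\ge0}$ be the orthonormal polynomials with respect to $x^{4j}\,d\mu(x)$. Assume that there exists a strictly increasing function $f:\{0,1,2,\dots\}\to\mathbb{R}$ with $2f(0)+1>0$ such that for all $j=0,1,\dots,r+1$ and every integer $k\ge0$, as $n\to\infty$ (with $n\ge k$), $$(p_{2n}^{[4j]})^{(2k)}(0)\cong C_{k,j}\,(-1)^n\,n^{f(2k+2j)},\qquad (p_{2n+1}^{[4j]})^{(2k+1)}(0)\cong C'_{k,j}\,(-1)^n\,n^{f(2k+2j+1)},$$ where $C_{k,j},C'_{k,j}$ are nonzero constants independent of $n$. For $n\ge r+1$ let $(\lambda_{j,n})_{j=0}^{r+1}$ and $(\lambda^*_{j,n})_{j=0}^{r+1}$ be the coefficients in the connection formulas $$q_{2n}(x)=\sum_{j=0}^{r+1}\lambda_{j,n}\,x^{2j}\,p_{2n-2j}^{[4j]}(x),\qquad q_{2n+1}(x)=\sum_{j=0}^{r+1}\lambda^*_{j,n}\,x^{2j}\,p_{2n+1-2j}^{[4j]}(x).$$ Then for each $j=0,1,\dots,r+1$ the limits $\lim_n\lambda_{j,n}=\lambda_j\in\mathbb{R}$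 and $\lim_n\lambda^*_{j,n}=\lambda^*_j\in\mathbb{R}$ exist. Moreover, if all the masses $M_0,\dots,M_{2r+1}$ are positive, then $$\lim_n\lambda_{j,n}=\lim_n\lambda^*_{j,n}=0\quad (j=0,1,\dots,r),\qquad \lim_n\lambda_{r+1,n}\ne0,\qquad \lim_n\lambda^*_{r+1,n}\neq0.$$
   Context: All moments of $\mu$ are finite; $\mu$ symmetric means it is invariant under $x\mapsto-x$. Orthonormal polynomials are normalized with positive leading coefficients, the $n$-th one having exact degree $n$. The notation $x_n\cong y_n$ means $x_n/y_n\to1$ as $n\to\infty$; asymptotics are for fixed $k$ and $j$. The coefficients in both connection formulas exist for every $n\ge r+1$ for any symmetric $\mu$ as here (and are uniquely determined, since $p_{2m}^{[4j]}(0)\ne0$ and $(p_{2m+1}^{[4j]})'(0)\neq0$ for all $m$). *)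

(* Defs.v *)
From mathcomp Require Import all_boot all_order all_algebra.
From mathcomp Require Import all_classical all_reals all_analysis.

Set Implicit Arguments.
Unset Strict Implicit.
Unset Printing Implicit Defensive.

Import Order.TTheory GRing.Theory Num.Theory.
Import numFieldNormedType.Exports.

Local Open Scope classical_set_scope.
Local Open Scope ring_scope.

Definition msupport (R : realType) (mu : set R -> \bar R) : set R :=
  [set x | forall U : set R, open U -> U x -> (0 < mu U)%E].

(* A measure on the open interval (-d, d) is encoded as a Borel measure on the
   whole line for which the complement of (-d, d) is null; d may be +oo. *)
Definition carried_by_sym_itv (R : realType) (d : \bar R)
    (mu : set R -> \bar R) : Prop :=
  mu (~` [set x | ((`|x|)%:E < d)%E]) = 0%E.

Definition symmetric_measure (R : realType)
    (mu : {finite_measure set R -> \bar R}) : Prop :=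
  forall A : set R, measurable A -> pushforward mu (-%R : R -> R) A = mu A.

Definition finite_moments (R : realType)
    (mu : {finite_measure set R -> \bar R}) : Prop :=
  forall n : nat, mu.-integrable setT (fun x : R => (x ^+ n)%:E).

(* The integral of p q against the measure x^m dmu. *)
Definition power_form (R : realType) (mu : {finite_measure set R -> \bar R})
    (m : nat) (p q : {poly R}) : R :=
  \int[mu]_x (p.[x] * q.[x] * x ^+ m).

Definition sobolev_form (R : realType) (mu : {finite_measure set R -> \bar R})
    (s : nat) (M : 'I_s -> R) (p q : {poly R}) : R :=
  \int[mu]_x (p.[x] * q.[x]) + \sum_(i < s) M i * p^`(i).[0] * q^`(i).[0].

Definition orthonormal_polys (R : realType)
    (B : {poly R} -> {poly R} -> R) (p : nat -> {poly R}) : Prop :=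
  [/\ forall n, size (p n) = n.+1,
      forall n, 0 < lead_coef (p n) &
      forall m n, B (p m) (p n) = (m == n)%:R].

Definition asymp_equiv (R : realType) (x y : nat -> R) : Prop :=
  (x n / y n) @[n --> \oo] --> (1 : R).

(* Main.v *)
(* Fix a parity and let [L] be integration against mu, [P k] the orthonormal
   polynomials of [L] of that parity. Both [q_n] and [x^(2j) p^{[4j]}] are
   orthogonal to all high powers of x, hence of the form
   [A P n + \sum_(m <= r) beta_m K_m], where [K_m] is the kernel
   [\sum_(k < n) (P k)_m P k] and [beta_m] is a moment against a low power of x;
   on a set S of indices the m-th coefficient is proportional to [beta_m], and
   off S [beta_m = 0]. For [q_n], S is the set of positive masses; for
   [x^(2j) p^{[4j]}], S is {m < j} and the m-th coefficient is 0 on S.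
   By Stolz-Cesaro the coefficients of the kernels, divided by n and by the
   growth [D_i = c_i (-1)^n n^(g i)] of the coefficients of [P n], tend to the
   Cauchy matrix [1 / (g i + g k + 1)], and a positive mass only adds
   [O(n^(- 2 g i - 1))], which vanishes in the limit. Solving the limit system
   gives the limits of [- n D_m beta_m], which depend on S alone, and then
   normalization gives [A -> 1].
   Comparing [A] and [beta] on both sides of the connection formula yields a
   linear system for the connection coefficients whose limit matrix is
   triangular and invertible; if all masses are positive, its right-hand side
   is the last column. *)
Require Import Defs.
From HB Require Import structures.
From mathcomp Require Import all_boot all_order all_algebra.
From mathcomp Require Import all_classical all_reals all_analysis.
From mathcomp Require Import ring lra zify.

Import Order.TTheory GRing.Theory Num.Theory.
Import numFieldNormedType.Exports.

Local Open Scope classical_set_scope.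
Local Open Scope ring_scope.

(** * Growth of power sums *)

(** Past some [N] the increments of [D] = S - l b are at most e/2 times those of b. Telescoping
    bounds |D n| by |D N| + e/2 (b n - b N), and |D N| / b n tends to 0. Divergence of b is stated
    through its inverses, and b 0 = 0 is allowed because the powers n^a start there. *)
Lemma stolz_cesaro (R : realType) (S b : nat -> R) (l : R)
    (b0 : 0 <= b 0%N) (b_incr : forall n, b n < b n.+1)
    (bV : (b n)^-1 @[n --> \oo] --> (0 : R)) :
  (S n.+1 - S n) / (b n.+1 - b n) @[n --> \oo] --> l ->
  S n / b n @[n --> \oo] --> l.
Proof.
move=> Sb.
have b_gt0 n : 0 < b n.+1.
  by elim: n => [|n IH]; [exact: le_lt_trans b0 _|exact: lt_trans IH _].
apply/cvgrPdist_le => e e0.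
have e20 : 0 < e / 2 by rewrite divr_gt0.
move/cvgrPdist_le: Sb => /(_ _ e20) [N _ HN].
pose D n := S n - l * b n.
have DN n : `|D (N + n)%N| <= `|D N| + e / 2 * (b (N + n)%N - b N).
  elim: n => [|n IH]; first by rewrite addn0 subrr mulr0 addr0.
  have db : 0 < b (N + n).+1 - b (N + n)%N by rewrite subr_gt0.
  have : `|D (N + n).+1 - D (N + n)%N| <= e / 2 * (b (N + n).+1 - b (N + n)%N).
    rewrite -ler_pdivrMr// -[X in _ / X]gtr0_norm// -normf_div.
    have := HN (N + n)%N (leq_addr _ _); rewrite distrC.
    congr (`|_| <= _); rewrite /D; field.
    by rewrite gt_eqF.
  rewrite addnS => step.
  have -> : D (N + n).+1 = D (N + n)%N + (D (N + n).+1 - D (N + n)%N).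
    by rewrite addrC subrK.
  apply: le_trans (ler_normD _ _) _; move: IH step; lra.
have DV : `|D N| * (b n)^-1 @[n --> \oo] --> (0 : R).
  by rewrite -[0](mulr0 `|D N|); apply: cvgMr; exact: bV.
move/cvgrPdist_le: DV => /(_ _ e20) DV.
near=> n.
have nN : (N <= n)%N by near: n; exists N.
have bn : 0 < b n.
  have : (0 < n)%N by near: n; exists 1%N.
  by case: (n).
have -> : l - S n / b n = - D n / b n.
  by rewrite /D; field; rewrite gt_eqF.
have := DN (n - N)%N; rewrite subnKC// => Dn.
have bN : 0 <= b N by case: (N) => // k; exact: ltW.
rewrite normf_div normrN (gtr0_norm bn) ler_pdivrMr//.
have : `|D N| / b n <= e / 2.
  have : `|0 - `|D N| / b n| <= e / 2 by near: n.
  by rewrite sub0r normrN ger0_norm// divr_ge0// ltW.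
rewrite ler_pdivrMr//; nra.
Unshelve. all: by end_near. Qed.

Lemma cvg_natr_powR_inv (R : realType) (a : R) : 0 < a ->
  (n%:R `^ a)^-1 @[n --> \oo] --> (0 : R).
Proof.
move=> a0; rewrite -(cvg_shiftS (fun n => (n%:R `^ a)^-1)) /=.
have /cvg_at_rightP := @powR_cvg0 R a a0.
move=> /(_ (fun n => n.+1%:R^-1)) H.
apply: cvg_trans (H _); last first.
  by split; [move=> n; rewrite invr_gt0 | exact: cvg_harmonic].
apply: near_eq_cvg; near=> n.
by rewrite -powR_inv1// -powRrM mulrC powRrM powR_inv1// powR_ge0.
Unshelve. all: by end_near. Qed.

(** With h = 1/n this is ((1 + h)^a - 1) / h, a difference quotient of x^a at 1. *)
Lemma cvg_powR_increment (R : realType) (a : R) :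
  (n.+1%:R `^ a - n%:R `^ a) / n%:R `^ (a - 1) @[n --> \oo] --> a.
Proof.
have [dx dv] := is_derive1_powR a (ltr01 : (0 : R) < 1).
move: dv; rewrite powR1 mulr1 => dv.
have /cvg_dnbhs_at_right/cvg_at_rightP := dx.
rewrite -/(derive _ _ _) dv => /(_ (fun n => n.+1%:R^-1)) H.
rewrite -(cvg_shiftS
  (fun n => (n.+1%:R `^ a - n%:R `^ a) / n%:R `^ (a - 1))) /=.
apply: cvg_trans (H _); last first.
  by split; [move=> n; rewrite invr_gt0 | exact: cvg_harmonic].
apply: near_eq_cvg; near=> n.
have n0 : (n.+1%:R : R) != 0 by rewrite pnatr_eq0.
rewrite powRB ?n0 ?implybT// powRr1// powR1 invrK /= scaler1.
have -> : n.+1%:R^-1 + 1 = n.+2%:R / n.+1%:R :> R.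
  by rewrite -[n.+2]addn1 natrD mulrDl divff// div1r addrC.
rewrite powRM// ?invr_ge0//.
have na : (n.+1%:R `^ a : R) != 0 by rewrite gt_eqF// powR_gt0.
have -> : (n.+1%:R^-1 : R) `^ a = (n.+1%:R `^ a)^-1.
  by rewrite -powR_inv1// -powRrM mulrC powRrM powR_inv1// powR_ge0.
rewrite /GRing.scale /=; field; rewrite na nat1r n0.
Unshelve. all: by end_near. Qed.

(** Stolz-Cesaro against n^(e + 1), whose increments are equivalent to (e + 1) n^e. *)
Lemma cvg_power_sum (R : realType) (u : nat -> R) (e : R) : 0 < e + 1 ->
  u n / n%:R `^ e @[n --> \oo] --> (1 : R) ->
  (\sum_(k < n) u k) / n%:R `^ (e + 1) @[n --> \oo] --> (e + 1)^-1.
Proof.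
move=> e0 ue.
apply: (@stolz_cesaro R (fun n => \sum_(k < n) u k) (fun n => n%:R `^ (e + 1))).
- exact: powR_ge0.
- by move=> n; apply: gt0_ltr_powR; rewrite ?nnegrE// ltr_nat.
- exact: cvg_natr_powR_inv.
have H := cvg_powR_increment R (e + 1).
rewrite addrK in H.
have H2 : n%:R `^ e / (n.+1%:R `^ (e + 1) - n%:R `^ (e + 1)) @[n --> \oo] -->
    (e + 1)^-1.
  under eq_fun do rewrite -invf_div.
  by apply: (cvgV _ H); rewrite gt_eqF.
rewrite -[(e + 1)^-1]mul1r.
apply: cvg_trans (cvgM ue H2).
apply: near_eq_cvg; near=> n.
have n0 : (0 < n%:R :> R) by rewrite ltr0n; near: n; exists 1%N.
rewrite big_ord_recr /= addrAC subrr add0r.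
by rewrite mulrA divfK// gt_eqF// powR_gt0.
Unshelve. all: by end_near. Qed.

(** * Linear systems of Cauchy type *)

Lemma cvg_det (R : realType) (n : nat) (A : nat -> 'M[R]_n) (B : 'M[R]_n) :
  (forall i k, A m i k @[m --> \oo] --> B i k) ->
  \det (A m) @[m --> \oo] --> \det B.
Proof.
move=> AB; rewrite /determinant.
apply: cvg_big => [|s _]; first exact: add_continuous.
apply: cvgM; first exact: cvg_cst.
by apply: cvg_big => [|i _]; [exact: mul_continuous | exact: AB].
Qed.

(** Cramer's rule: the limit determinant is nonzero, so [A m] is eventually invertible and the
    solution is a quotient of polynomials in convergent entries. Convergence of [x] is a conclusion,
    not an assumption. *)
Lemma cvg_linear_solution (R : realType) (n : nat) (A : nat -> 'M[R]_n)
    (B : 'M[R]_n) (x v : nat -> 'cV[R]_n) (w : 'cV[R]_n) :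
  B \in unitmx ->
  (forall i k, A m i k @[m --> \oo] --> B i k) ->
  (forall i, v m i 0 @[m --> \oo] --> w i 0) ->
  (\forall m \near \oo, A m *m x m = v m) ->
  forall i, x m i 0 @[m --> \oo] --> (invmx B *m w) i 0.
Proof.
move=> uB AB vw Axv i.
have dB : \det B != 0 by rewrite -unitfE -unitmxE.
have dA : \det (A m) @[m --> \oo] --> \det B by exact: cvg_det.
have -> : (invmx B *m w) i 0 = (\sum_k \adj B i k * w k 0) / \det B.
  by rewrite /invmx uB -scalemxAl !mxE mulrC.
have H : (\sum_k \adj (A m) i k * v m k 0) / \det (A m) @[m --> \oo] -->
    (\sum_k \adj B i k * w k 0) / \det B.
  apply: cvgM; last exact: cvgV.
  apply: cvg_big => [|k _]; first exact: add_continuous.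
  apply: cvgM; last exact: vw.
  under eq_fun do rewrite mxE; rewrite mxE.
  apply: cvgM; first exact: cvg_cst.
  apply: cvg_det => a b.
  by under eq_fun do rewrite !mxE; rewrite !mxE; exact: AB.
apply: cvg_trans H; apply: near_eq_cvg; near=> m.
have dAm : \det (A m) != 0.
  near: m; move/cvgrPdist_lt: dA => /(_ `|\det B|).
  rewrite normr_gt0 => /(_ dB); apply: filterS => m.
  by apply: contraTneq => ->; rewrite subr0 ltxx.
have Am : A m *m x m = v m by near: m.
have -> : \sum_k \adj (A m) i k * v m k 0 = (\adj (A m) *m v m) i 0.
  by rewrite mxE.
by rewrite -Am mulmxA mul_adj_mx mul_scalar_mx mxE mulrC mulKf.
Unshelve. all: by end_near. Qed.

Section Cauchy.
Context (R : realType) (n : nat).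
Implicit Types (g b : 'I_n -> R) (S : pred 'I_n) (c : R).

(* Numerator of [c - \sum_s b s / ('X + g s + 1)]. *)
Definition cauchy_num g b c : {poly R} :=
  c *: \prod_t ('X - (- (g t + 1))%:P) -
  \sum_s b s *: \prod_(t in predC1 s) ('X - (- (g t + 1))%:P).

(** The zero of the numerator supplied by index i: the evaluation point of a Cauchy equation, or a
    pole cancelled by b i = 0. *)
Definition cauchy_node g S i : R := if S i then g i else - (g i + 1).

Lemma horner_prod_node g (P : pred 'I_n) x :
  (\prod_(t | P t) ('X - (- (g t + 1))%:P)).[x] = \prod_(t | P t) (x + g t + 1).
Proof.
rewrite horner_prod; apply: eq_bigr => t _.
by rewrite hornerXsubC opprK addrA.
Qed.

(** Only the i-th summand lacks the vanishing factor. For injective g the numerator thus vanishes at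
    this pole exactly when b i = 0. *)
Lemma cauchy_num_at_pole g b c i :
  (cauchy_num g b c).[- (g i + 1)] = - (b i * \prod_(t | t != i) (g t - g i)).
Proof.
rewrite /cauchy_num hornerD hornerN hornerZ horner_prod_node.
rewrite (bigD1 i)//= -addrA addNr mul0r mulr0 add0r; congr (- _).
rewrite horner_sum (bigD1 i)//= hornerZ horner_prod_node.
rewrite [X in _ + X]big1 ?addr0 => [|s si]; last first.
  rewrite hornerZ horner_prod_node (bigD1 i) ?inE 1?eq_sym//=.
  by rewrite -addrA addNr mul0r mulr0.
by congr (_ * _); apply: eq_bigr => t _; ring.
Qed.

Lemma cauchy_num_root g b c x : (forall t, x + g t + 1 != 0) ->
  \sum_s (x + g s + 1)^-1 * b s = c -> (cauchy_num g b c).[x] = 0.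
Proof.
move=> xN0 <-.
rewrite /cauchy_num hornerD hornerN hornerZ horner_prod_node horner_sum.
rewrite mulr_suml -sumrB big1// => s _.
rewrite hornerZ horner_prod_node (bigD1 s)//=.
by rewrite -(eq_bigl _ _ (fun t => erefl (t != s))); field.
Qed.

Lemma size_cauchy_tail g b :
  (size (\sum_s b s *: \prod_(t in predC1 s) ('X - (- (g t + 1))%:P))%R <= n)%N.
Proof.
apply: (leq_trans (size_sum _ _ _)); apply/bigmax_leqP => s _.
apply: (leq_trans (size_scale_leq _ _)).
rewrite -big_enum size_prod_XsubC -cardE cardC1 card_ord.
by case: (n) s => // -[].
Qed.

Lemma size_cauchy_num g b c :
  (size (cauchy_num g b c) <= (c != 0%R) + n)%N.
Proof.
apply: (leq_trans (size_polyD _ _)); rewrite size_polyN geq_max.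
rewrite (leq_trans (size_cauchy_tail _ _)) ?leq_addl// andbT.
have [->|c0] := eqVneq c 0; first by rewrite scale0r size_poly0.
by rewrite size_scale// -big_enum size_prod_XsubC -cardE card_ord.
Qed.


(** Every g i exceeds -1/2 and every -(g k + 1) lies below it, so the two kinds of nodes never
    meet. *)
Lemma cauchy_node_inj g S : injective g -> (forall i, 0 < 2 * g i + 1) ->
  injective (cauchy_node g S).
Proof.
move=> g_inj g_pos i k; rewrite /cauchy_node.
case: (S i); case: (S k) => E; first exact: g_inj.
- by exfalso; have := g_pos i; have := g_pos k; lra.
- by exfalso; have := g_pos i; have := g_pos k; lra.
- by apply: g_inj; lra.
Qed.

Lemma cauchy_num_roots g S b c i :
  (forall i, 0 < 2 * g i + 1) ->
  (if S i then \sum_s (g i + g s + 1)^-1 * b s = c else b i = 0) ->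
  root (cauchy_num g b c) (cauchy_node g S i).
Proof.
move=> g_pos; rewrite /cauchy_node /root; case: (S i) => H.
  apply/eqP/cauchy_num_root => // t.
  by rewrite gt_eqF//; have := g_pos i; have := g_pos t; lra.
by rewrite cauchy_num_at_pole H mul0r oppr0.
Qed.

(** For c = 0 the numerator has degree below n but n distinct zeros, so it is the zero polynomial;
    its values at the poles then give b = 0. *)
Lemma cauchy_homogeneous_eq0 g S b : injective g ->
  (forall i, 0 < 2 * g i + 1) ->
  (forall i, if S i then \sum_s (g i + g s + 1)^-1 * b s = 0 else b i = 0) ->
  forall k, b k = 0.
Proof.
move=> g_inj g_pos H k.
have num0 : cauchy_num g b 0 = 0.
  apply: (@roots_geq_poly_eq0 _ _ [seq cauchy_node g S i | i <- enum 'I_n]).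
  - by apply/allP => _ /mapP[i _ ->]; apply: cauchy_num_roots => //; exact: H.
  - by rewrite map_inj_uniq ?enum_uniq//; exact: cauchy_node_inj.
  - rewrite size_map -cardE card_ord.
    by have := size_cauchy_num g b 0; rewrite eqxx.
have := cauchy_num_at_pole g b 0 k.
rewrite num0 horner0 => /esym/eqP; rewrite oppr_eq0 mulf_eq0 => /orP[/eqP//|].
rewrite prodf_seq_eq0 => /hasP[t _ /andP[tk]].
by rewrite subr_eq0 => /eqP/g_inj/eqP; rewrite (negbTE tk).
Qed.

(* The rational function [1 - \sum_s b s / ('X + g s + 1)] would otherwise have
   too many zeros: besides the nodes (the [g i] for [i] in [S], and the cancelled
   poles for [i] outside [S]) the pole at [- (g k + 1)] would be cancelled. *)
Lemma cauchy_solution_neq0 g S b k : injective g ->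
  (forall i, 0 < 2 * g i + 1) ->
  (forall i, if S i then \sum_s (g i + g s + 1)^-1 * b s = 1 else b i = 0) ->
  S k -> b k != 0.
Proof.
move=> g_inj g_pos H Sk; apply/eqP => bk.
have : cauchy_num g b 1 = 0.
  apply: (@roots_geq_poly_eq0 _ _
    (- (g k + 1) :: [seq cauchy_node g S i | i <- enum 'I_n])).
  - apply/andP; split; first by rewrite /root cauchy_num_at_pole bk mul0r oppr0.
    by apply/allP => _ /mapP[i _ ->]; apply: cauchy_num_roots => //; exact: H.
  - rewrite /= map_inj_uniq ?enum_uniq ?andbT; last exact: cauchy_node_inj.
    apply/mapP => -[i _]; rewrite /cauchy_node; case: ifPn => Si E.
      by have := g_pos i; have := g_pos k; lra.
    suff ik : k = i by rewrite -ik Sk in Si.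
    by apply: g_inj; lra.
  - rewrite /= size_map -cardE card_ord.
    by have := size_cauchy_num g b 1; rewrite oner_neq0.
(* A monic product of n linear factors would equal a sum of degree below n. *)
move/eqP; rewrite /cauchy_num subr_eq0 scale1r => /eqP E.
have := size_cauchy_tail g b; rewrite -E.
by rewrite -big_enum size_prod_XsubC -cardE card_ord ltnn.
Qed.

Definition cauchy_mx g S : 'M[R]_n :=
  \matrix_(i, k) if S i then (g i + g k + 1)^-1 else (i == k)%:R.

(** The common limit of all the rescaled moments: Cauchy equations with right-hand side 1 on S, and
    zero unknowns off S. *)
Definition cauchy_sol g S : 'cV[R]_n :=
  invmx (cauchy_mx g S) *m \col_i (S i)%:R.

Lemma cauchy_mxE g S (b : 'cV[R]_n) i : (cauchy_mx g S *m b) i 0 =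
  if S i then \sum_s (g i + g s + 1)^-1 * b s 0 else b i 0.
Proof.
rewrite mxE; case: ifPn => Si.
  by apply: eq_bigr => s _; rewrite mxE Si.
rewrite (bigD1 i)//= mxE (negbTE Si) eqxx mul1r big1 ?addr0// => s si.
by rewrite mxE (negbTE Si) eq_sym (negbTE si) mul0r.
Qed.

Lemma cauchy_mx_unit g S : injective g -> (forall i, 0 < 2 * g i + 1) ->
  cauchy_mx g S \in unitmx.
Proof.
move=> g_inj g_pos; rewrite -unitmx_tr -row_free_unit; apply/inj_row_free => v.
move=> /(congr1 trmx); rewrite trmx_mul trmxK trmx0 => vM.
apply: trmx_inj; rewrite trmx0; apply/colP => k; rewrite [RHS]mxE.
apply: (@cauchy_homogeneous_eq0 g S (fun i => v^T i 0) g_inj g_pos) => i.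
by have := cauchy_mxE g S v^T i; rewrite vM mxE; case: (S i).
Qed.

Lemma cauchy_solP g S i : injective g -> (forall i, 0 < 2 * g i + 1) ->
  if S i then \sum_s (g i + g s + 1)^-1 * cauchy_sol g S s 0 = 1
  else cauchy_sol g S i 0 = 0.
Proof.
move=> g_inj g_pos; have := cauchy_mxE g S (cauchy_sol g S) i.
rewrite mulKVmx ?cauchy_mx_unit// mxE.
by case: (S i).
Qed.

Lemma cauchy_sol_neq0 g S k : injective g -> (forall i, 0 < 2 * g i + 1) ->
  S k -> cauchy_sol g S k 0 != 0.
Proof.
move=> g_inj g_pos Sk.
apply: (@cauchy_solution_neq0 g S (fun i => cauchy_sol g S i 0)) => // i.
exact: cauchy_solP.
Qed.

End Cauchy.

(** * Asymptotics of the coefficients *)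

Section Asymptotics.
Context (R : realType) (s : nat) (g c : 'I_s -> R) (a : 'I_s -> nat -> R).

Definition growth (i : 'I_s) (n : nat) : R := c i * (-1) ^+ n * n%:R `^ g i.

(** Coefficient i of the kernel K_k, with [a i l] standing for the i-th coefficient of P l. *)
Definition kernel_coef (i k : 'I_s) (n : nat) : R := \sum_(l < n) a i l * a k l.

Hypotheses (g_inj : injective g) (g_pos : forall i, 0 < 2 * g i + 1)
  (c_neq0 : forall i, c i != 0)
  (a_growth : forall i, asymp_equiv (a i) (growth i)).

Lemma growth_neq0 i n : (0 < n)%N -> growth i n != 0.
Proof.
by move=> n0; rewrite !mulf_neq0 ?signr_eq0 ?c_neq0// gt_eqF// powR_gt0// ltr0n.
Qed.

Lemma growthM i k n : (0 < n)%N ->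
  growth i n * growth k n = c i * c k * n%:R `^ (g i + g k).
Proof.
move=> n0; rewrite powRD ?pnatr_eq0 -?lt0n ?n0 ?implybT// /growth.
by have := sqrr_sign R n; rewrite expr2 => E; ring: E.
Qed.

Lemma mulr_growthM i k n : (0 < n)%N ->
  n%:R * growth i n * growth k n = c i * c k * n%:R `^ (g i + g k + 1).
Proof.
move=> n0; rewrite -mulrA growthM//.
rewrite [X in _ = _ * X]powRD ?pnatr_eq0 -?lt0n ?n0 ?implybT//.
by rewrite powRr1 ?ler0n//; ring.
Qed.

(** The signs (-1)^n cancel in the product of two coefficients, leaving a power sum of exponent g i
    + g k > -1. *)
Lemma cvg_kernel_coef i k :
  kernel_coef i k n / (n%:R * growth i n * growth k n) @[n --> \oo] -->
  (g i + g k + 1)^-1.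
Proof.
have e0 : 0 < g i + g k + 1 by have := g_pos i; have := g_pos k; lra.
have := @cvg_power_sum R (fun n => a i n * a k n / (c i * c k)) _ e0.
move=> H; apply: cvg_trans (H _).
  apply: near_eq_cvg; near=> n.
  have n0 : (0 < n)%N by near: n; exists 1%N.
  rewrite mulr_growthM// -mulr_suml -/(kernel_coef i k n).
  by rewrite -mulrA -invfM mulrC.
rewrite -[X in _ --> X](mulr1 1).
apply: cvg_trans (cvgM (a_growth i) (a_growth k)).
apply: near_eq_cvg; near=> n.
have n0 : (0 < n)%N by near: n; exists 1%N.
by rewrite [LHS]mulf_div growthM// invfM mulrA.
Unshelve. all: by end_near. Qed.

(** This is the weight with which a mass enters the rescaled system; it vanishes because the
    exponent 2 g i + 1 is positive. *)
Lemma cvg_mass_inv i :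
  (n%:R * growth i n * growth i n)^-1 @[n --> \oo] --> (0 : R).
Proof.
have e0 : 0 < g i + g i + 1 by have := g_pos i; lra.
rewrite -[X in _ --> X](mulr0 (c i * c i)^-1).
apply: cvg_trans (cvgMl_tmp (cvg_natr_powR_inv R _ e0)).
apply: near_eq_cvg; near=> n.
by rewrite mulr_growthM ?invfM//; near: n; exists 1%N.
Unshelve. all: by end_near. Qed.

(** Here w i is the inverse of a mass, or 0 when coefficient i is forced to vanish. The limits do
    not involve w, so both situations lead to the same Cauchy system. *)
Lemma cvg_masses (S : pred 'I_s) (w : 'I_s -> R) (A : nat -> R)
    (beta : 'I_s -> nat -> R) (N : nat) :
  (forall n, (N <= n)%N -> [/\ 0 < A n,
     forall i, if S i
       then A n * a i n + \sum_k beta k n * kernel_coef i k n = - w i * beta i n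
       else beta i n = 0
     & A n ^+ 2 - A n * \sum_i beta i n * a i n = 1]) ->
  A n @[n --> \oo] --> (1 : R) /\
  forall i, - (n%:R * growth i n * beta i n) @[n --> \oo] --> cauchy_sol R s g S i 0.
Proof.
move=> HA.
(* Dividing row i in S by [A n * growth i n] turns the equations into H x = v, and H tends to the
   Cauchy matrix. *)
pose x n : 'cV[R]_s := \col_i - (n%:R * growth i n * beta i n / A n).
pose v n : 'cV[R]_s := \col_i if S i then a i n / growth i n else 0.
pose H n : 'M[R]_s := \matrix_(i, k) if S i then
  kernel_coef i k n / (n%:R * growth i n * growth k n) +
  (i == k)%:R * w i * (n%:R * growth i n * growth i n)^-1 else (i == k)%:R.
have x_cvg i : x n i 0 @[n --> \oo] --> cauchy_sol R s g S i 0.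
  apply: (cvg_linear_solution R s H (cauchy_mx R s g S) x v).
  - exact: cauchy_mx_unit.
  - move=> {}i k; under eq_fun do rewrite mxE; rewrite mxE.
    case: (S i); last exact: cvg_cst.
    rewrite -[(g i + g k + 1)^-1]addr0; apply: cvgD; first exact: cvg_kernel_coef.
    rewrite -[X in _ --> X](mulr0 ((i == k)%:R * w i)).
    by apply: cvgMl_tmp; exact: cvg_mass_inv.
  - move=> {}i; under eq_fun do rewrite mxE; rewrite mxE.
    by case: (S i); [exact: a_growth | exact: cvg_cst].
  near=> n.
  have n0 : (0 < n)%N by near: n; exists 1%N.
  have nN : (N <= n)%N by near: n; exists N.
  have [A0 eqn _] := HA n nN.
  have An0 : A n != 0 by rewrite gt_eqF.
  apply/colP => {}i; rewrite !mxE.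
  have := eqn i; case: ifPn => Si eqi; last first.
    rewrite (bigD1 i)//= !mxE (negbTE Si) eqxx eqi mulr0 mul0r oppr0 mulr0.
    rewrite add0r big1// => k ki.
    by rewrite !mxE (negbTE Si) eq_sym (negbTE ki) mul0r.
  have gi := growth_neq0 i n n0.
  have nn : (n%:R : R) != 0 by rewrite pnatr_eq0 -lt0n.
  transitivity (- (\sum_k beta k n * kernel_coef i k n + w i * beta i n)
                / (A n * growth i n)); last first.
    have -> : \sum_k beta k n * kernel_coef i k n =
        - w i * beta i n - A n * a i n by rewrite -eqi addrAC subrr add0r.
    by field; rewrite An0 gi.
  under eq_bigr => k _ do rewrite !mxE Si mulrDl.
  rewrite big_split /= [X in _ + X](bigD1 i)//= eqxx [X in _ + (_ + X)]big1.
    rewrite addr0 opprD mulrDl -mulNr; congr (_ + _); last first.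
      by rewrite mul1r; field; rewrite An0 gi nn.
    rewrite -sumrN mulr_suml; apply: eq_bigr => k _.
    by field; rewrite An0 gi nn growth_neq0.
  by move=> k ki; rewrite eq_sym (negbTE ki) !mul0r.
(* In terms of x the normalization reads A^2 (1 + O(1/n)) = 1. *)
have A2_cvg : A n ^+ 2 @[n --> \oo] --> (1 : R).
  have y_cvg : 1 + \sum_i x n i 0 * (a i n / growth i n) * n%:R^-1 @[n --> \oo]
      --> (1 : R).
    rewrite -[X in _ --> X]addr0; apply: cvgD; first exact: cvg_cst.
    have S0 : \sum_(i < s) (0 : R) = 0 by rewrite big1.
    rewrite -[X in _ --> X]S0.
    apply: cvg_big => [|i _]; first exact: add_continuous.
    rewrite -[X in _ --> X](mulr0 (cauchy_sol R s g S i 0 * 1)).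
    apply: cvgM; first by apply: cvgM => //; exact: a_growth.
    by rewrite -(cvg_shiftS (fun n => n%:R^-1 : R)); exact: cvg_harmonic.
  rewrite -[X in _ --> X](invr1 R).
  apply: cvg_trans (cvgV (oner_neq0 R) y_cvg).
  apply: near_eq_cvg; near=> n.
  have n0 : (0 < n)%N by near: n; exists 1%N.
  have nN : (N <= n)%N by near: n; exists N.
  have [A0 _ eqn] := HA n nN.
  have An0 : A n != 0 by rewrite gt_eqF.
  have nn : (n%:R : R) != 0 by rewrite pnatr_eq0 -lt0n.
  have E : A n ^+ 2 * (1 + \sum_i x n i 0 * (a i n / growth i n) * n%:R^-1) = 1.
    rewrite -[RHS]eqn mulrDr mulr1 -mulrN -sumrN !mulr_sumr; congr (_ + _).
    apply: eq_bigr => i _; rewrite mxE.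
    by field; rewrite An0 nn growth_neq0.
  have y0 : 1 + \sum_i x n i 0 * (a i n / growth i n) * n%:R^-1 != 0.
    by apply/eqP => y0; move: E; rewrite y0 mulr0 => /esym/eqP; rewrite oner_eq0.
  by apply: (mulIf y0); rewrite E mulVf.
(* Positivity of [A n] selects the square root. *)
have A_cvg : A n @[n --> \oo] --> (1 : R).
  rewrite -[X in _ --> X](sqrtr1 R).
  apply: cvg_trans (continuous_cvg _ (@sqrt_continuous R 1) A2_cvg).
  apply: near_eq_cvg; near=> n.
  have nN : (N <= n)%N by near: n; exists N.
  have [A0 _ _] := HA n nN.
  by rewrite /= sqrtr_sqr gtr0_norm.
split=> // i; rewrite -[X in _ --> X]mulr1.
apply: cvg_trans (cvgM (x_cvg i) A_cvg).
apply: near_eq_cvg; near=> n.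
have nN : (N <= n)%N by near: n; exists N.
have [A0 _ _] := HA n nN.
by rewrite /= mxE mulNr divfK// gt_eqF.
Unshelve. all: by end_near. Qed.

(* Limit of the system for the connection coefficients: row 0 compares the
   components along [P n] and row [k.+1] the k-th moments. *)
Definition connection_mx : 'M[R]_s.+1 :=
  \matrix_(i, j) if unlift ord0 i is Some k
    then cauchy_sol R s g (fun l => (l < j)%N) k 0 else 1.

(** Column j solves the system for {l < j}, hence vanishes in rows k + 1 with k >= j: the matrix is
    upper triangular. Its diagonal is 1 followed by solution entries at indices inside their set,
    which are nonzero. *)
Lemma connection_mx_unit : connection_mx \in unitmx.
Proof.
rewrite -unitmx_tr unitmxE det_trig; last first.
  apply/is_trig_mxP => j i ji; rewrite !mxE.
  case: unliftP ji => [k ->|-> //] /= jk.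
  have := cauchy_solP R s g (fun l : 'I_s => (l < j)%N) k g_inj g_pos.
  by rewrite ltnNge -ltnS jk.
rewrite unitfE; apply/prodf_neq0 => i _; rewrite !mxE.
case: unliftP => [k {1}->|_]; last exact: oner_neq0.
by apply: cauchy_sol_neq0 => //=; rewrite lift0.
Qed.

Lemma cvg_connection (S : pred 'I_s) (A : nat -> R) (beta : 'I_s -> nat -> R)
    (AT : 'I_s.+1 -> nat -> R) (betaT : 'I_s.+1 -> 'I_s -> nat -> R)
    (lam : 'I_s.+1 -> nat -> R) :
  A n @[n --> \oo] --> (1 : R) ->
  (forall i, - (n%:R * growth i n * beta i n) @[n --> \oo] -->
    cauchy_sol R s g S i 0) ->
  (forall j, AT j n @[n --> \oo] --> (1 : R)) ->
  (forall j i, - (n%:R * growth i n * betaT j i n) @[n --> \oo] -->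
    cauchy_sol R s g (fun l => (l < j)%N) i 0) ->
  (\forall n \near \oo, A n = \sum_j lam j n * AT j n /\
     forall i, beta i n = \sum_j lam j n * betaT j i n) ->
  (forall j, cvgn (lam j)) /\
  ((forall i, S i) -> forall j, limn (lam j) = (j == ord_max)%:R).
Proof.
move=> A_cvg b_cvg AT_cvg bT_cvg E.
pose rhs : 'cV[R]_s.+1 :=
  \col_i if unlift ord0 i is Some k then cauchy_sol R s g S k 0 else 1.
have lam_cvg j : lam j n @[n --> \oo] --> (invmx connection_mx *m rhs) j 0.
  pose G n : 'M[R]_s.+1 := \matrix_(i, j) if unlift ord0 i is Some k
    then - (n%:R * growth k n * betaT j k n) else AT j n.
  pose x n : 'cV[R]_s.+1 := \col_j lam j n.
  pose v n : 'cV[R]_s.+1 := \col_i if unlift ord0 i is Some k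
    then - (n%:R * growth k n * beta k n) else A n.
  have := cvg_linear_solution R _ G connection_mx x v rhs connection_mx_unit.
  move=> /(_ _ _ _ j) H; apply: cvg_trans (H _ _ _).
  - by apply: near_eq_cvg; near=> n; rewrite mxE.
  - move=> i k; under eq_fun do rewrite mxE; rewrite mxE.
    by case: unliftP => [l _|_]; [exact: bT_cvg | exact: AT_cvg].
  - move=> i; under eq_fun do rewrite mxE; rewrite mxE.
    by case: unliftP => [l _|_]; [exact: b_cvg | exact: A_cvg].
  near=> n; have [EA Eb] : A n = \sum_j lam j n * AT j n /\
    forall i, beta i n = \sum_j lam j n * betaT j i n by near: n.
  apply/colP => i; rewrite !mxE; case: unliftP => [k ik|i0].
    rewrite Eb mulr_sumr -sumrN; apply: eq_bigr => l _.
    by rewrite !mxE ik liftK; ring.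
  by rewrite EA; apply: eq_bigr => l _; rewrite !mxE i0 unlift_none mulrC.
split=> [j|S_all j]; first by apply/cvg_ex; eexists; exact: lam_cvg.
rewrite (cvg_lim _ (lam_cvg j))//.
(* In the last column the set {l < s} is everything, as is S here. *)
have -> : rhs = connection_mx *m delta_mx ord_max 0.
  rewrite -colE; apply/colP => i; rewrite !mxE; case: unliftP => // k _.
  congr (cauchy_sol R s g _ k 0).
  by apply/funext => l; rewrite S_all /= ltn_ord.
by rewrite mulKmx ?connection_mx_unit// mxE eqxx andbT.
Unshelve. all: by end_near. Qed.

End Asymptotics.

(** * Moment functionals and orthonormal polynomials *)

(** [true] means odd; as a number, e is then the lowest exponent of that parity. *)
Definition has_parity {R : realType} (e : bool) (p : {poly R}) : Prop :=
  forall i, odd i != e -> p`_i = 0.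

Lemma coef_comp_polyNX {R : realType} (p : {poly R}) i :
  (p \Po - 'X)`_i = (-1) ^+ i * p`_i.
Proof.
rewrite -[p]coefK poly_def linear_sum /= !coef_sum mulr_sumr.
apply: eq_bigr => k _; rewrite linearZ /= comp_Xn_poly.
rewrite -scaleN1r exprZn !coefZ coefXn.
by have [->|ik] := eqVneq i k; rewrite ?mulr0// !mulr1 mulrC.
Qed.

Lemma sum_parity {R : realType} (F : nat -> R) (e : bool) n :
  (forall k, odd k != e -> F k = 0) ->
  \sum_(k < 2 * n + e) F k = \sum_(l < n) F (2 * l + e)%N.
Proof.
move=> F0; elim: n => [|n IH].
  rewrite muln0 add0n big_ord0; case: e F0 => F0; last by rewrite big_ord0.
  by rewrite big_ord1 F0.
rewrite [RHS]big_ord_recr /= -IH.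
have -> : (2 * n.+1 + e = (2 * n + e).+2)%N by lia.
rewrite 2!big_ord_recr /= -addrA; congr (_ + _).
by rewrite [F (_.+1)]F0 ?addr0// oddS oddD mul2n odd_double; case: (e).
Qed.

Lemma span_of_size {R : realType} (p : nat -> {poly R}) n (h : {poly R}) :
  (forall n, size (p n) = n.+1) -> (size h <= n)%N ->
  exists c : nat -> R, h = \sum_(k < n) c k *: p k.
Proof.
move=> sp; elim: n h => [|n IH] h.
  by rewrite size_poly_leq0 => /eqP ->; exists (fun=> 0); rewrite big_ord0.
move=> sh; pose x := h`_n / lead_coef (p n).
have lc0 : lead_coef (p n) != 0 by rewrite lead_coef_eq0 -size_poly_gt0 sp.
have [|c Ec] := IH (h - x *: p n).
  apply/leq_sizeP => j; rewrite leq_eqVlt => /predU1P[<-|nj].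
    by rewrite coefB coefZ /x -[(p n)`_n]/((p n)`_(n.+1).-1) -sp divfK ?subrr.
  by rewrite coefB coefZ !nth_default ?mulr0 ?subrr ?sp ?(leq_trans sh).
exists (fun k => if (k < n)%N then c k else x).
rewrite big_ord_recr /= ltnn; apply/eqP; rewrite -subr_eq Ec; apply/eqP.
by apply: eq_bigr => k _; rewrite ltn_ord.
Qed.

Lemma orthonormal_lower (R : realType) (B : {poly R} -> {poly R} -> R)
    (p : nat -> {poly R}) n (h : {poly R}) :
  (forall q, scalar (B q)) -> orthonormal_polys B p -> (size h <= n)%N ->
  B (p n) h = 0.
Proof.
move=> B_lin [sp _ on] /(@span_of_size _ _ _ _ sp)[c ->].
pose Bn : {scalar {poly R}} :=
  HB.pack (B (p n)) (GRing.isLinear.Build R {poly R} R _ (B (p n)) (B_lin _)).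
rewrite -[B (p n)]/(Bn : _ -> _) linear_sum big1// => k _.
by rewrite linearZ /= on gtn_eqF ?mulr0.
Qed.

Section Functional.
Context (R : realType) (L : {scalar {poly R}}).

Lemma functional_lower (w : {poly R}) (p : nat -> {poly R}) n (h : {poly R}) :
  orthonormal_polys (fun p q => L (p * q * w)) p -> (size h <= n)%N ->
  L (p n * h * w) = 0.
Proof.
move=> p_on; apply: (orthonormal_lower _ (fun p q => L (p * q * w))) => //.
by move=> q a u v; rewrite mulrDr mulrDl linearD -scalerAr -scalerAl linearZ.
Qed.

Lemma functional_expansion (p : nat -> {poly R}) n (h : {poly R}) :
  orthonormal_polys (fun p q => L (p * q)) p -> (size h <= n)%N ->
  h = \sum_(k < n) L (h * p k) *: p k.
Proof.
case=> sp _ on /(@span_of_size _ _ _ _ sp)[c E].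
rewrite {1}E; apply: eq_bigr => k _; congr (_ *: _).
rewrite E mulr_suml linear_sum (bigD1 k)//= -scalerAl linearZ /= on eqxx.
rewrite mulr1 big1 ?addr0// => i ik.
by rewrite -scalerAl linearZ /= on (inj_eq val_inj) (negbTE ik) mulr0.
Qed.

(** The difference of p_n and (-1)^n p_n(-x) has degree below n, and evenness of the weight makes it
    orthogonal to all such polynomials, so it is zero. *)
Lemma orthonormal_parity m (p : nat -> {poly R}) n :
  (forall q, L (q \Po - 'X) = L q) ->
  orthonormal_polys (fun p q => L (p * q * 'X^(2 * m))) p ->
  has_parity (odd n) (p n).
Proof.
move=> L_sym p_on; have [sp lc on] := p_on.
pose h := p n - (-1) ^+ n *: (p n \Po - 'X).
suff h0 : h = 0.
  move=> i ni; move/(congr1 (fun q : {poly R} => q`_i)): h0.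
  rewrite coefB coefZ coef_comp_polyNX coef0 mulrA -exprD.
  rewrite -signr_odd oddD addbC -negb_eqb ni expr1; lra.
have sh : (size h <= n)%N.
  apply/leq_sizeP => j; rewrite leq_eqVlt => /predU1P[<-|nj].
    by rewrite coefB coefZ coef_comp_polyNX mulrA -expr2 sqrr_sign mul1r subrr.
  by rewrite coefB coefZ coef_comp_polyNX nth_default ?mulr0 ?subrr ?sp.
have h_orth (g : {poly R}) : (size g <= n)%N -> L (h * g * 'X^(2 * m)) = 0.
  move=> sg; rewrite /h !mulrBl linearB /= (functional_lower _ _ _ _ p_on)// sub0r.
  rewrite -!scalerAl linearZ /= -L_sym !comp_polyM -comp_polyA.
  have -> : (- 'X : {poly R}) \Po (- 'X) = 'X by rewrite linearN /= comp_polyX opprK.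
  rewrite comp_polyXr comp_Xn_poly exprM sqrrN -exprM.
  rewrite (functional_lower _ _ _ _ p_on) ?mulr0 ?oppr0//.
  by rewrite size_comp_poly2// size_polyN size_polyX.
have [c E] := span_of_size _ _ _ sp sh.
rewrite E big1// => k _.
have := h_orth (p k); rewrite sp => /(_ (ltn_ord k)).
rewrite E !mulr_suml linear_sum (bigD1 k)//= -!scalerAl linearZ /= on eqxx.
rewrite mulr1 big1 ?addr0 => [->|i ik]; first by rewrite scale0r.
by rewrite -!scalerAl linearZ /= on (inj_eq val_inj) (negbTE ik) mulr0.
Qed.

End Functional.

(** * Polynomials orthogonal to all but finitely many low powers *)

Section Perturbation.
Context (R : realType) (L : {scalar {poly R}}) (s : nat) (e : bool).
Context (P : nat -> {poly R}).
Hypothesis P_on : orthonormal_polys (fun p q => L (p * q)) P.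
Hypothesis P_parity : forall n, has_parity (odd n) (P n).

Lemma has_parityB (p q : {poly R}) a : has_parity e p -> has_parity e q ->
  has_parity e (p - a *: q).
Proof. by move=> pe qe i ie; rewrite coefB coefZ pe// qe// mulr0 subr0. Qed.

Lemma odd_double_bool n : odd (2 * n + e) = e.
Proof. by rewrite oddD mul2n odd_double oddb. Qed.

Definition moment (Q : {poly R}) (k : nat) : R := L (Q * 'X^(2 * k + e)).

(** Against h of low degree, Q is seen only through its s lowest moments of parity e. *)
Lemma functional_moments (Q h : {poly R}) n : (s <= n)%N ->
  (forall m, (s <= m < n)%N -> moment Q m = 0) ->
  has_parity e h -> (size h <= 2 * n + e)%N ->
  L (Q * h) = \sum_(k < s) moment Q k * h`_(2 * k + e).
Proof.
move=> sn Q0 he sh.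
have -> : h = \poly_(i < 2 * n + e) h`_i.
  apply/polyP => i; rewrite coef_poly; case: ltnP => // ni.
  by rewrite nth_default// (leq_trans sh).
rewrite {1}poly_def mulr_sumr linear_sum.
pose F k := h`_k * L (Q * 'X^k).
transitivity (\sum_(k < 2 * n + e) F k).
  by apply: eq_bigr => k _; rewrite -scalerAr linearZ.
rewrite sum_parity => [|k ke]; last by rewrite /F he ?mul0r.
rewrite -!(big_mkord xpredT (fun k => F (2 * k + e)%N)) (big_cat_nat (leq0n s) sn)/=.
rewrite [X in _ + X]big_nat [X in _ + X]big1 => [|k /Q0 Qk]; last first.
  by rewrite /F -/(moment Q k) Qk mulr0.
rewrite addr0 big_mkord; apply: eq_bigr => k _.
rewrite coef_poly ifT /F 1?mulrC// ltn_add2r ltn_mul2l /=.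
exact: leq_trans (ltn_ord k) sn.
Qed.

(** Expand Q in the P k. The top term is A P_N; each lower Fourier coefficient is a combination of
    the s moments, and regrouping by moment produces the kernels. The last identity pairs Q with A
    P_N plus a remainder of lower degree. *)
Lemma connection_identities (Q : {poly R}) n : (s <= n)%N ->
  size Q = (2 * n + e).+1 -> has_parity e Q ->
  (forall m, (s <= m < n)%N -> moment Q m = 0) ->
  let A := L (Q * P (2 * n + e)) in
  [/\ A = lead_coef Q / lead_coef (P (2 * n + e)%N),
      forall i, Q`_(2 * i + e) = A * (P (2 * n + e)%N)`_(2 * i + e) +
        \sum_(k < s) moment Q k * \sum_(l < n)
          (P (2 * l + e)%N)`_(2 * i + e) * (P (2 * l + e)%N)`_(2 * k + e)
    & L (Q * Q) = A ^+ 2 + \sum_(k < s) moment Q k *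
        (Q`_(2 * k + e) - A * (P (2 * n + e)%N)`_(2 * k + e))].
Proof.
move=> sn sQ Qe Q0 A; have [sP lcP PP] := P_on.
set N := (2 * n + e)%N in A sQ *.
have PNe : has_parity e (P N) by have := P_parity N; rewrite odd_double_bool.
have lcP0 : lead_coef (P N) != 0 by rewrite gt_eqF.
have size_rest c : c = lead_coef Q / lead_coef (P N) ->
    (size (Q - c *: P N)%R <= N)%N.
  move=> ->; apply/leq_sizeP => j; rewrite leq_eqVlt => /predU1P[<-|nj].
    rewrite coefB coefZ -[(P N)`_N]/((P N)`_(N.+1).-1) -(sP N) divfK//.
    by rewrite lead_coefE sQ subrr.
  by rewrite coefB coefZ !nth_default ?mulr0 ?subrr ?sP ?sQ.
have EA : A = lead_coef Q / lead_coef (P N).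
  set c := _ / _; rewrite /A -[Q](subrK (c *: P N)) mulrDl linearD /=.
  rewrite -scalerAl [L (c *: _)]linearZ /= PP eqxx mulr1 [_ * P N]mulrC.
  rewrite -[P N * _]mulr1 (functional_lower _ _ 1 _ _ _ _ (size_rest _ _)) ?add0r//.
  by split=> // ? ?; rewrite mulr1.
split=> //.
- move=> i; rewrite {1}(functional_expansion _ _ _ N.+1 Q P_on) ?sQ//.
  rewrite coef_sum big_ord_recr /= addrC coefZ -/A; congr (_ + _).
  pose F k := L (Q * P k) * (P k)`_(2 * i + e).
  transitivity (\sum_(k < 2 * n + e) F k).
    by apply: eq_bigr => k _; rewrite coefZ.
  rewrite sum_parity => [|k ke]; last first.
    by rewrite /F P_parity ?mulr0// odd_double_bool eq_sym.
  under [RHS]eq_bigr do rewrite mulr_sumr.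
  rewrite exchange_big /=; apply: eq_bigr => l _.
  rewrite /F (functional_moments _ _ n)//; last 2 first.
  + by have := P_parity (2 * l + e); rewrite odd_double_bool.
  + by rewrite sP; have := ltn_ord l; lia.
  by rewrite mulr_suml; apply: eq_bigr => k _; ring.
- rewrite -{2}[Q](subrK (A *: P N)) mulrDr linearD /= addrC.
  rewrite -scalerAr linearZ /= -/A -expr2; congr (_ + _).
  rewrite (functional_moments _ _ n)//.
  + by apply: eq_bigr => k _; rewrite coefB coefZ.
  + exact: has_parityB.
  + exact: size_rest.
Qed.

Context (g c : 'I_s -> R).
Hypotheses (g_inj : injective g) (g_pos : forall i, 0 < 2 * g i + 1)
  (c_neq0 : forall i, c i != 0).
Hypothesis P_growth : forall i : 'I_s,
  asymp_equiv (fun n => (P (2 * n + e)%N)`_(2 * i + e)) (growth R s g c i).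

(** Subtracting the normalization from the formula for L(Q Q) cancels the coefficients of Q and
    leaves A^2 - A sum beta_i a_i = 1. *)
Lemma cvg_perturbed (S : pred 'I_s) (w : 'I_s -> R) (Q : nat -> {poly R}) :
  (forall n, (s <= n)%N ->
    [/\ size (Q n) = (2 * n + e).+1, 0 < lead_coef (Q n) & has_parity e (Q n)]) ->
  (forall n m, (s <= m < n)%N -> moment (Q n) m = 0) ->
  (forall n (i : 'I_s), (s <= n)%N -> if S i
     then (Q n)`_(2 * i + e) = - w i * moment (Q n) i else moment (Q n) i = 0) ->
  (forall n, (s <= n)%N ->
    L (Q n * Q n) - \sum_(k < s) moment (Q n) k * (Q n)`_(2 * k + e) = 1) ->
  L (Q n * P (2 * n + e)) @[n --> \oo] --> (1 : R) /\
  forall i : 'I_s, - (n%:R * growth R s g c i n * moment (Q n) i) @[n --> \oo] -->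
    cauchy_sol R s g S i 0.
Proof.
move=> Q1 Q2 Q3 Q4.
apply: (cvg_masses R s g c (fun i n => (P (2 * n + e)%N)`_(2 * i + e))
  g_inj g_pos c_neq0 P_growth S w (fun n => L (Q n * P (2 * n + e)))
  (fun i n => moment (Q n) i) s) => n sn.
have [sQ lcQ Qe] := Q1 _ sn.
have [EA coefE LE] := connection_identities (Q n) n sn sQ Qe (Q2 n).
split.
- by rewrite EA divr_gt0//; have [_ ->] := P_on.
- by move=> i; have := Q3 n i sn; case: (S i) => // <-; rewrite coefE.
rewrite -(Q4 n sn) LE -addrA; congr (_ + _).
rewrite -sumrB mulr_sumr -sumrN; apply: eq_bigr => k _; ring.
Qed.

End Perturbation.

(** * Connection coefficients within one parity *)

Section ConnectionCoefficients.
Context (R : realType) (L : {scalar {poly R}}) (s : nat) (e : bool).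
Context (p : 'I_s.+1 -> nat -> {poly R}).
Hypothesis L_sym : forall q, L (q \Po - 'X) = L q.
Hypothesis p_on : forall j : 'I_s.+1,
  orthonormal_polys (fun p q => L (p * q * 'X^(4 * j))) (p j).
Let mom := moment R L e.

Lemma base_orthonormal : orthonormal_polys (fun p q => L (p * q)) (p ord0).
Proof.
have [sp lcp pp] := p_on ord0; split=> // m n.
by rewrite -pp muln0 expr0 mulr1.
Qed.

Lemma shifted_parity j n : has_parity (odd n) (p j n).
Proof.
apply: (orthonormal_parity _ L (2 * j)%N) => //.
by have := p_on j; rewrite -[4%N]/(2 * 2)%N -mulnA.
Qed.

Definition shifted (j : 'I_s.+1) (n : nat) : {poly R} :=
  'X^(2 * j) * p j (2 * n + e - 2 * j)%N.

Lemma coef_shifted j n i : (shifted j n)`_i =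
  if (i < 2 * j)%N then 0 else (p j (2 * n + e - 2 * j)%N)`_(i - 2 * j).
Proof. exact: coefXnM. Qed.

(** For n >= s the index 2n + e - 2j is a true difference, since j <= s. *)
Lemma shifted_basic j n : (s <= n)%N ->
  [/\ size (shifted j n) = (2 * n + e).+1, 0 < lead_coef (shifted j n)
    & has_parity e (shifted j n)].
Proof.
move=> sn; have [sp lcp _] := p_on j; have := ltn_ord j => js.
have jn : (2 * j <= 2 * n + e)%N by lia.
split.
- rewrite /shifted mulrC size_mulXn ?sp; first by lia.
  by rewrite -size_poly_gt0 sp.
- by rewrite /shifted lead_coefM lead_coefXn mul1r.
move=> i ie; rewrite coef_shifted; case: ltnP => // ji.
apply: shifted_parity; rewrite !oddB// oddD !mul2n !odd_double !addbF.
by move: ie; rewrite oddb.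
Qed.

(** Moving x^(2j) across, the integrand is p^{[4j]} times a lower power times the weight x^(4j). *)
Lemma moment_shifted (j : 'I_s.+1) n m : (s <= n)%N -> (j <= m < n)%N ->
  mom (shifted j n) m = 0.
Proof.
move=> sn /andP[jm mn]; rewrite /mom /moment /shifted.
have jn : (2 * j <= 2 * n + e)%N by lia.
have -> : 'X^(2 * j) * p j (2 * n + e - 2 * j)%N * 'X^(2 * m + e) =
    p j (2 * n + e - 2 * j)%N * 'X^(2 * m + e - 2 * j) * 'X^(4 * j).
  rewrite mulrAC -exprD mulrC -mulrA -exprD; congr (_ * 'X^_); lia.
apply: (functional_lower _ _ _ _ _ _ (p_on j)).
by rewrite size_polyXn; lia.
Qed.

Context (g c : 'I_s -> R).
Hypotheses (g_inj : injective g) (g_pos : forall i, 0 < 2 * g i + 1)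
  (c_neq0 : forall i, c i != 0).
Hypothesis p_growth : forall i : 'I_s, asymp_equiv
  (fun n => (p ord0 (2 * n + e)%N)`_(2 * i + e)) (growth R s g c i).

(** Coefficients below x^(2j) vanish and so do the moments from j on, hence each product of the two
    is 0 and the normalization is that of p^{[4j]}. *)
Lemma cvg_shifted (j : 'I_s.+1) :
  L (shifted j n * p ord0 (2 * n + e)%N) @[n --> \oo] --> (1 : R) /\
  forall i : 'I_s, - (n%:R * growth R s g c i n * mom (shifted j n) i) @[n --> \oo] -->
    cauchy_sol R s g (fun l => (l < j)%N) i 0.
Proof.
have small n (k : 'I_s) : (k < j)%N -> (shifted j n)`_(2 * k + e) = 0.
  by move=> kj; rewrite coef_shifted ifT//; case: (e); lia.
apply: (cvg_perturbed R L s e _ base_orthonormal (shifted_parity ord0)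
  g c g_inj g_pos c_neq0 p_growth _ (fun=> 0)) => [||n i sn|n sn].
- by move=> n sn; exact: shifted_basic.
- move=> n m /andP[sm mn]; apply: moment_shifted; first by lia.
  by have := ltn_ord j; lia.
- case: ifPn => ij; first by rewrite small// oppr0 mul0r.
  by apply: moment_shifted => //; have := ltn_ord i; lia.
rewrite big1 ?subr0 => [|k _]; last first.
  case: (ltnP k j) => kj; first by rewrite small ?mulr0.
  rewrite -/mom moment_shifted ?mul0r//; have := ltn_ord k; lia.
have [_ _ pp] := p_on j.
rewrite -[RHS]/(true%:R) -(eqxx (2 * n + e - 2 * j)%N) -pp /shifted.
congr (L _); rewrite mulrACA -exprD mulrC; congr (_ * 'X^_); lia.
Qed.

(** Orthogonality gives moment = - M i times coefficient: where M i is nonzero this is a mass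
    equation with w = 1 / M i, elsewhere the moment is 0. *)
Lemma cvg_connection_coefs (Q : nat -> {poly R}) (M : 'I_s -> R)
    (lam : 'I_s.+1 -> nat -> R) :
  (forall n, (s <= n)%N ->
    size (Q n) = (2 * n + e).+1 /\ 0 < lead_coef (Q n)) ->
  (forall n m, (s <= m < n)%N -> mom (Q n) m = 0) ->
  (forall n (i : 'I_s), (s <= n)%N ->
    mom (Q n) i = - (M i * (Q n)`_(2 * i + e))) ->
  (forall n, (s <= n)%N ->
    L (Q n * Q n) + \sum_(k < s) M k * (Q n)`_(2 * k + e) ^+ 2 = 1) ->
  (forall n, (s <= n)%N -> Q n = \sum_j lam j n *: shifted j n) ->
  (forall j, cvgn (lam j)) /\
  ((forall i, M i != 0) -> forall j, limn (lam j) = (j == ord_max)%:R).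
Proof.
move=> Q1 Q2 Q3 Q4 conn.
have Qe n : (s <= n)%N -> has_parity e (Q n).
  move=> sn i ie; rewrite conn// coef_sum big1// => j _.
  by have [_ _ h] := shifted_basic j n sn; rewrite coefZ h ?mulr0.
have [A_cvg b_cvg] : L (Q n * p ord0 (2 * n + e)%N) @[n --> \oo] --> (1 : R) /\
  forall i : 'I_s, - (n%:R * growth R s g c i n * mom (Q n) i) @[n --> \oo] -->
    cauchy_sol R s g (fun i => M i != 0) i 0.
  apply: (cvg_perturbed R L s e _ base_orthonormal (shifted_parity ord0)
    g c g_inj g_pos c_neq0 p_growth _ (fun i => (M i)^-1)) => [||n i sn|n sn] //.
  - by move=> n sn; have [? ?] := Q1 n sn; split=> //; exact: Qe.
  - have := Q3 n i sn; rewrite /mom; have [->|Mi] /= := eqVneq (M i) 0.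
      by move=> ->; rewrite mul0r oppr0.
    by move=> ->; rewrite mulrNN mulKf.
  rewrite -[RHS](Q4 n sn); congr (_ + _); rewrite -sumrN.
  by apply: eq_bigr => k _; rewrite -/mom Q3// expr2; ring.
apply: (cvg_connection R s g c g_inj g_pos
  (fun i => M i != 0) _ (fun i n => mom (Q n) i) _
  (fun j i n => mom (shifted j n) i) lam A_cvg b_cvg
  (fun j => (cvg_shifted j).1) (fun j => (cvg_shifted j).2)).
(* The equations come from pairing the connection formula with P_(2n+e) and with the powers
   x^(2i+e). *)
exists s => // n /= sn; split.
  rewrite conn// mulr_suml linear_sum; apply: eq_bigr => j _.
  by rewrite -scalerAl linearZ.
move=> i; rewrite /mom /moment conn// mulr_suml linear_sum.
by apply: eq_bigr => j _; rewrite -scalerAl linearZ.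
Qed.

End ConnectionCoefficients.

(** * Discrete Sobolev forms *)

Lemma integrable_horner (R : realType) (mu : {finite_measure set R -> \bar R})
    (p : {poly R}) :
  finite_moments mu -> mu.-integrable setT (EFin \o horner p).
Proof.
move=> mom.
have -> : EFin \o horner p =
    (fun x => \sum_(i < size p) (p`_i)%:E * (x ^+ i)%:E)%E.
  apply/funext => x; rewrite /= horner_coef -sumEFin.
  by apply: eq_bigr => i _; rewrite EFinM.
by apply: integrable_sum => // i _; apply: integrableZl => //; exact: mom.
Qed.

Lemma poly_functional (R : realType) (mu : {finite_measure set R -> \bar R}) :
  finite_moments mu ->
  exists L : {scalar {poly R}}, forall p, L p = \int[mu]_x p.[x].
Proof.
move=> mom; pose L0 (p : {poly R}) : R := \int[mu]_x p.[x].
have L0_lin : scalar L0.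
  move=> a p q; rewrite /L0.
  under eq_Rintegral do rewrite hornerD hornerZ.
  rewrite RintegralD//; first rewrite RintegralZl//.
  - exact: integrable_horner.
  - have := integrable_horner R mu (a *: p) mom.
    by apply: eq_integrable => // x _; rewrite /= hornerZ.
  - exact: integrable_horner.
pose L : {scalar {poly R}} :=
  HB.pack L0 (GRing.isLinear.Build R {poly R} R _ L0 L0_lin).
by exists L.
Qed.

Lemma Rintegral_symmetric (R : realType)
    (mu : {finite_measure set R -> \bar R}) (p : {poly R}) :
  symmetric_measure mu -> finite_moments mu ->
  \int[mu]_x p.[- x] = \int[mu]_x p.[x].
Proof.
move=> sym mom; rewrite /Rintegral; congr fine.
transitivity (\int[pushforward mu (-%R : R -> R)]_x (p.[x])%:E)%E; last first.
  by apply: eq_measure_integral => A mA _; exact: sym.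
rewrite integral_pushforward//.
- have := integrable_horner R mu p mom; move/integrableP => []//.
- have := integrable_horner R mu (p \Po - 'X) mom.
  apply: eq_integrable => // x _.
  by rewrite /= horner_comp !hornerE.
Qed.

Lemma horner0_derivn (R : realType) (p : {poly R}) i :
  p^`(i).[0] = p`_i * i`!%:R.
Proof. by rewrite horner_coef0 coef_derivn addn0 ffactnn mulr_natr. Qed.

(* The masses act on derivatives at 0; acting on coefficients they pick up
   [k!^2]. The value is 0 for [n <= k]. *)
Definition mass {R : realType} {n : nat} (M : 'I_n -> R) (k : nat) : R :=
  oapp M 0 (insub k) * k`!%:R ^+ 2.

Lemma sobolev_formE (R : realType) (mu : {finite_measure set R -> \bar R})
    (n : nat) (M : 'I_n -> R) (L : {scalar {poly R}}) (p q : {poly R}) :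
  (forall p, L p = \int[mu]_x p.[x]) ->
  sobolev_form mu M p q = L (p * q) + \sum_(k < n) mass M k * p`_k * q`_k.
Proof.
move=> LE; rewrite /sobolev_form LE; congr (_ + _).
  by apply: eq_Rintegral => x _; rewrite hornerM.
apply: eq_bigr => k _; rewrite /mass valK /= !horner0_derivn; ring.
Qed.

Lemma power_formE (R : realType) (mu : {finite_measure set R -> \bar R})
    (m : nat) (L : {scalar {poly R}}) (p q : {poly R}) :
  (forall p, L p = \int[mu]_x p.[x]) ->
  power_form mu m p q = L (p * q * 'X^m).
Proof.
by move=> LE; rewrite LE; apply: eq_Rintegral => x _; rewrite !hornerM hornerXn.
Qed.

(** One statement for both parities. Among the 2r + 2 masses, r + 1 act on derivatives of each
    parity, so the systems above have size s = r + 1. *)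
Lemma sobolev_connection (R : realType)
    (mu : {finite_measure set R -> \bar R}) (r : nat) (e : bool)
    (M : 'I_(2 * r + 2) -> R)
    (q : nat -> {poly R}) (p : 'I_r.+2 -> nat -> {poly R})
    (f : nat -> R) (lam : 'I_r.+2 -> nat -> R) :
  symmetric_measure mu -> finite_moments mu ->
  orthonormal_polys (sobolev_form mu M) q ->
  (forall j : 'I_r.+2, orthonormal_polys (power_form mu (4 * j)) (p j)) ->
  (forall m n : nat, (m < n)%N -> f m < f n) -> 0 < 2 * f 0%N + 1 ->
  (forall k : nat, exists2 C : R, C != 0 &
    asymp_equiv (fun n => (p ord0 (2 * n + e)%N)^`(2 * k + e).[0])
      (fun n => C * (-1) ^+ n * n%:R `^ f (2 * k + e)%N)) ->
  (forall n, (r < n)%N -> q (2 * n + e)%N =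
    \sum_(j < r.+2) lam j n *: ('X^(2 * j) * p j (2 * n + e - 2 * j)%N)) ->
  (forall j, cvgn (lam j)) /\
  ((forall i, M i != 0) -> forall j, limn (lam j) = (j == ord_max)%:R).
Proof.
move=> sym mom q_on p_on f_incr f0 asym conn.
have [L LE] := poly_functional R mu mom.
have L_sym h : L (h \Po - 'X) = L h.
  rewrite !LE -(Rintegral_symmetric R mu h)//.
  by apply: eq_Rintegral => x _; rewrite horner_comp !hornerE.
have p_on' (j : 'I_r.+2) :
    orthonormal_polys (fun p q => L (p * q * 'X^(4 * j))) (p j).
  have [sp lc pp] := p_on j; split=> // m n.
  by rewrite -pp (power_formE _ _ _ L).
have [C C0 HC] : exists2 C : nat -> R, (forall k, C k != 0) & forall k,
    asymp_equiv (fun n => (p ord0 (2 * n + e)%N)^`(2 * k + e).[0])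
      (fun n => C k * (-1) ^+ n * n%:R `^ f (2 * k + e)%N).
  exists (fun k => sval (cid2 (asym k))) => k; by case: (cid2 (asym k)).
pose g (i : 'I_r.+1) := f (2 * i + e)%N.
(* The asymptotics concern derivatives at 0; the factorial converts them to coefficients. *)
pose c (i : 'I_r.+1) := C i / (2 * i + e)`!%:R.
have fact0 k : (k`!%:R : R) != 0 by rewrite pnatr_eq0 -lt0n fact_gt0.
have f_inj : injective f.
  by move=> m n E; have [/f_incr|/f_incr|//] := ltngtP m n; rewrite E ltxx.
have g_inj : injective g by move=> i k /f_inj E; apply/val_inj => /=; lia.
have g_pos i : 0 < 2 * g i + 1.
  suff : f 0%N <= g i by move: f0; lra.
  rewrite /g; case: (_ + _)%N => // k; exact/ltW/f_incr.
have c_neq0 i : c i != 0 by rewrite mulf_neq0 ?C0// invr_eq0.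
have p_growth (i : 'I_r.+1) : asymp_equiv
    (fun n => (p ord0 (2 * n + e)%N)`_(2 * i + e)) (growth R r.+1 g c i).
  have := HC i; rewrite /asymp_equiv; apply: cvg_trans; apply: near_eq_cvg.
  near=> n; rewrite horner0_derivn /growth /c /g.
  by rewrite !invfM invrK; ring.
have [sq lcq qq] := q_on.
have formE := fun p q => sobolev_formE R mu _ M L p q LE.
have q_lower n m : (m < n)%N -> sobolev_form mu M (q n) 'X^m = 0.
  move=> mn; apply: (orthonormal_lower _ _ _ _ _ _ q_on).
    move=> h a u v; rewrite !formE mulrDr linearD /= -scalerAr linearZ /=.
    rewrite mulrDr addrACA mulr_sumr -big_split /=; congr (_ + _).
    by apply: eq_bigr => k _; rewrite coefD coefZ; ring.
  by rewrite size_polyXn.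
pose Mr (i : 'I_r.+1) := mass M (2 * i + e).
have mass_out k : (2 * r + 2 <= k)%N -> mass M k = 0.
  by move=> rk; rewrite /mass insubN ?mul0r// -leqNgt.
have q_moment n m : (2 * m + e < 2 * n + e)%N ->
    moment R L e (q (2 * n + e)%N) m =
    - (mass M (2 * m + e) * (q (2 * n + e)%N)`_(2 * m + e)).
  move=> mn; have := q_lower _ _ mn; rewrite formE -/(moment _ _ _ _ m) => /eqP.
  rewrite addr_eq0 => /eqP ->; congr (- _).
  have [mr|rm] := ltnP (2 * m + e) (2 * r + 2); last first.
    rewrite mass_out// mul0r big1// => k _.
    by rewrite coefXn ltn_eqF ?mulr0// (leq_trans (ltn_ord k)).
  rewrite (bigD1 (Ordinal mr))//= coefXn eqxx mulr1 big1 ?addr0// => k km.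
  by rewrite coefXn (_ : (k == _ :> nat) = false) ?mulr0//; exact: negbTE km.
(* Parity of q is read off the connection formula, whose terms all have parity e. *)
have q_parity n : (r < n)%N -> has_parity e (q (2 * n + e)%N).
  move=> rn i ie; rewrite conn// coef_sum big1// => j _.
  have [_ _ h] := shifted_basic R L r.+1 e p L_sym p_on' j n rn.
  by rewrite coefZ h ?mulr0.
have [lam_cvg lam_lim] : (forall j, cvgn (lam j)) /\
    ((forall i, Mr i != 0) -> forall j, limn (lam j) = (j == ord_max)%:R).
  apply: (cvg_connection_coefs R L r.+1 e p L_sym p_on' g c g_inj g_pos c_neq0
    p_growth (fun n => q (2 * n + e)%N)).
  - by move=> n _; rewrite sq.
  - move=> n m /andP[rm mn]; rewrite q_moment; last by lia.
    by rewrite mass_out ?mul0r ?oppr0//; lia.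
  - by move=> n i rn; rewrite q_moment//; have := ltn_ord i; lia.
  - move=> n rn; have := qq (2 * n + e)%N (2 * n + e)%N.
    rewrite formE eqxx mulr1n => <-; congr (_ + _).
    pose F k := mass M k * (q (2 * n + e)%N)`_k * (q (2 * n + e)%N)`_k.
    (* For e = 1 the range gains the index 2r + 2, where the mass is 0 by convention. *)
    have E : \sum_(k < 2 * r + 2) F k = \sum_(k < 2 * r.+1 + e) F k.
      have -> : (2 * r.+1 = 2 * r + 2)%N by lia.
      case: (e); last by rewrite addn0.
      by rewrite addn1 big_ord_recr /= /F mass_out// !mul0r addr0.
    rewrite -[RHS]/(\sum_(k < 2 * r + 2) F k) E sum_parity => [|k ke].
      by apply: eq_bigr => k _; rewrite /F -mulrA expr2.
    by rewrite /F q_parity ?mulr0.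
  - exact: conn.
split=> // M0 j; apply: lam_lim => i; rewrite /Mr /mass.
have ir : (2 * i + e < 2 * r + 2)%N by have := ltn_ord i; case: (e); lia.
by rewrite insubT /= mulf_neq0// expf_neq0.
Unshelve. all: by end_near. Qed.

Theorem theorem4 (R : realType) (d : \bar R)
    (mu : {finite_measure set R -> \bar R}) (r : nat)
    (M : 'I_(2 * r + 2) -> R)
    (q : nat -> {poly R}) (p : 'I_r.+2 -> nat -> {poly R})
    (f : nat -> R) (lam lam' : 'I_r.+2 -> nat -> R)
    (d_gt0 : (0 < d)%E)
    (mu_itv : carried_by_sym_itv d mu)
    (mu_sym : symmetric_measure mu)
    (mu_mom : finite_moments mu)
    (mu_supp : infinite_set (msupport mu))
    (M_ge0 : forall i, 0 <= M i)
    (q_on : orthonormal_polys (sobolev_form mu M) q)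
    (p_on : forall j : 'I_r.+2, orthonormal_polys (power_form mu (4 * j)) (p j))
    (f_incr : forall m n : nat, (m < n)%N -> f m < f n)
    (f0 : 0 < 2 * f 0%N + 1)
    (asym_even : forall (j : 'I_r.+2) (k : nat), exists2 C : R, C != 0 &
       asymp_equiv (fun n => (p j (2 * n)%N)^`(2 * k).[0])
         (fun n => C * (-1) ^+ n * n%:R `^ f (2 * k + 2 * j)%N))
    (asym_odd : forall (j : 'I_r.+2) (k : nat), exists2 C' : R, C' != 0 &
       asymp_equiv (fun n => (p j (2 * n + 1)%N)^`(2 * k + 1).[0])
         (fun n => C' * (-1) ^+ n * n%:R `^ f (2 * k + 2 * j + 1)%N))
    (conn_even : forall n : nat, (r + 1 <= n)%N ->
       q (2 * n)%N =
         \sum_(j < r.+2) lam j n *: ('X^(2 * j) * p j (2 * n - 2 * j)%N))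
    (conn_odd : forall n : nat, (r + 1 <= n)%N ->
       q (2 * n + 1)%N =
         \sum_(j < r.+2) lam' j n *: ('X^(2 * j) * p j (2 * n + 1 - 2 * j)%N)) :
  (forall j : 'I_r.+2, cvgn (lam j) /\ cvgn (lam' j)) /\
  ((forall i, 0 < M i) ->
    [/\ forall j : 'I_r.+2, (j <= r)%N ->
          limn (lam j) = 0 /\ limn (lam' j) = 0,
        limn (lam ord_max) != 0 &
        limn (lam' ord_max) != 0]).
Proof.
have ord0E k : (2 * k + 2 * (ord0 : 'I_r.+2) = 2 * k)%N by rewrite muln0 addn0.
have [cv_even lim_even] : (forall j, cvgn (lam j)) /\
    ((forall i, M i != 0) -> forall j, limn (lam j) = (j == ord_max)%:R).
  apply: (sobolev_connection R mu r false M q p f) => // [k|n rn].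
    have [C C0 HC] := asym_even ord0 k; exists C => //.
    rewrite ord0E in HC; move: HC; congr asymp_equiv; apply/funext => n.
      by rewrite !addn0.
    by rewrite addn0.
  by rewrite addn0 conn_even// addn1.
have [cv_odd lim_odd] : (forall j, cvgn (lam' j)) /\
    ((forall i, M i != 0) -> forall j, limn (lam' j) = (j == ord_max)%:R).
  apply: (sobolev_connection R mu r true M q p f) => // [k|n rn].
    have [C C0 HC] := asym_odd ord0 k; exists C => //.
    by rewrite ord0E in HC.
  by apply: conn_odd; rewrite addn1.
split=> [j|M_gt0]; first by split.
have M_neq0 i : M i != 0 by rewrite gt_eqF.
(* Both last limits equal 1, and all the others are 0. *)
split; [|by rewrite lim_even// eqxx oner_neq0|by rewrite lim_odd// eqxx oner_neq0].
move=> j jr; have jmax : (j == ord_max) = false.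
  by apply/eqP => E; rewrite E /= ltnn in jr.
by rewrite lim_even// lim_odd// jmax.
Qed.
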